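(* Let $H$ be either of the subgroups $\langle73,154\rangle$ (of order $4$) or $\langle10,64\rangle$ (of order $6$) of $(\mathbb Z/333\mathbb Z)^\times$, where the generators are residues modulo $333$. Then no $H$-invariant Legendre pair of length $333$ exists.
   Context: Sequence indices are taken modulo the sequence length. For a real sequence $x=(x_0,\dots,x_{L-1})$, its periodic autocorrelation is $\operatorname{PAF}_x(s)=\sum_{j=0}^{L-1}x_jx_{j+s}$. For odd $L$, two sequences $a,b\in\{\pm1\}^L$ form a Legendre pair (of length $L$) if $\operatorname{PAF}_a(s)+\operatorname{PAF}_b(s)=-2$ for all $1\le s<L$. For $H\leq(\mathbb Z/L\mathbb Z)^\times$, a sequence $x$ indexed by $\mathbb Z_L$ is $H$-invariant if $x_{hi}=x_i$ for all $h\in H$ and $i\in\mathbb Z_L$. A Legendre pair is $H$-invariant if both of its sequences are $H$-invariant. *)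

(* Defs.v *)
From mathcomp Require Import all_boot all_order all_algebra all_fingroup.

Set Implicit Arguments.
Unset Strict Implicit.
Unset Printing Implicit Defensive.

Import GRing.Theory.
Local Open Scope ring_scope.

(* Sequences of length L are functions on 'Z_L, so that indices are taken
   modulo L.  This is meaningful only for 1 < L: in MathComp 'Z_0 and 'Z_1 are
   both Z/2Z. *)

Definition PAF (R : pzRingType) (L : nat) (x : 'Z_L -> R) (s : 'Z_L) : R :=
  \sum_(j : 'Z_L) x j * x (j + s).

Definition pm1_seq (L : nat) (x : 'Z_L -> int) : Prop :=
  forall i : 'Z_L, x i = 1 \/ x i = -1.

Definition Legendre_pair (L : nat) (a b : 'Z_L -> int) : Prop :=
  [/\ odd L, pm1_seq a, pm1_seq b &
      forall s : nat, (1 <= s < L)%N -> PAF a s%:R + PAF b s%:R = -2].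

Definition seq_invariant (L : nat) (H : {set {unit 'Z_L}}) (x : 'Z_L -> int) :
    Prop :=
  forall (h : {unit 'Z_L}) (i : 'Z_L), h \in H -> x (val h * i) = x i.

Definition invariant_Legendre_pair (L : nat) (H : {set {unit 'Z_L}})
    (a b : 'Z_L -> int) : Prop :=
  [/\ Legendre_pair a b, seq_invariant H a & seq_invariant H b].

Lemma residue_is_unit (L r : nat) :
  (1 < L)%N -> coprime L r -> (r%:R : 'Z_L) \is a GRing.unit.
Proof. by move=> L_gt1; rewrite unitZpE. Qed.

Definition residue_unit (L r : nat) (L_gt1 : (1 < L)%N) (co_Lr : coprime L r) :
    {unit 'Z_L} :=
  FinRing.unit 'Z_L (residue_is_unit L_gt1 co_Lr).

(* isT proves 1 < 333 and the coprimality of r with 333 by computation. *)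
Definition H_73_154 : {group {unit 'Z_333}} :=
  <<[set @residue_unit 333 73 isT isT; @residue_unit 333 154 isT isT]>>%G.

Definition H_10_64 : {group {unit 'Z_333}} :=
  <<[set @residue_unit 333 10 isT isT; @residue_unit 333 64 isT isT]>>%G.

(* Main.v *)
Require Import Defs.
From Stdlib Require Import ZArith.
From mathcomp Require Import all_boot all_order all_algebra all_fingroup.
From mathcomp Require Import cyclic zify ssrZ.

(* Both groups act trivially modulo 9, and modulo 37 they are the subgroups of
   orders 4 and 6.  Summing a Legendre pair over the residue classes modulo
   d | 333 gives a pair (A, B) of integer sequences of length d with
   PAF_A(s) + PAF_B(s) = 668 [s = 0] - 2 * 333 / d.

   Order 4: take d = 37.  The transforms alpha and beta of A and B in
   F_167[X] / (1 + X + ... + X^36) satisfy alpha^2 + beta^2 = 668 = 0, because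
   -1 belongs to the group modulo 37.  As q = 167^9 is 6 modulo 37, an element
   of the group, alpha and beta are fixed by the q-th power Frobenius, and
   q = 3 (mod 4), so -1 is not a square for them: alpha = 0.  Hence the entries
   of A are congruent modulo 167; being at most 25 in absolute value, they are
   equal, whereas their sum is +1 or -1.

   Order 6: take d = 9.  Grouping the 37 summands of an entry into orbits gives
   A = e + 12 m and B = e' + 12 m' with e, e' of entries +1 or -1.  The
   correlations force sum m = sum m' = 0, |m|^2 + |m'|^2 = 4, and a
   relation between (e, m) and (e', m'), which a finite search excludes. *)

Set Implicit Arguments.
Unset Strict Implicit.
Unset Printing Implicit Defensive.

(** * The finite search in length 9 *)

Section NinthCompression.
Local Open Scope Z_scope.
Local Arguments Z.of_nat : simpl never.
Local Arguments Z.mul : simpl never.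
Local Arguments Z.add : simpl never.
Local Arguments Z.sub : simpl never.

Fixpoint dotZ (u v : seq Z) : Z :=
  if u is x :: u' then if v is y :: v' then x * y + dotZ u' v' else 0 else 0.
Definition sumZ (u : seq Z) : Z := foldr Z.add 0 u.
Definition addZ (u v : seq Z) := [seq p.1 + p.2 | p <- zip u v].
Definition pafZ (u : seq Z) (s : nat) : Z := dotZ u (rot s u).
Definition pm1 : pred Z := mem [:: 1; -1].
Local Arguments sumZ : simpl never.
Local Arguments addZ : simpl never.

Lemma sumZ_cons x u : sumZ (x :: u) = x + sumZ u. Proof. by []. Qed.
Lemma addZ_cons x u y v : addZ (x :: u) (y :: v) = x + y :: addZ u v.
Proof. by []. Qed.

Fixpoint words (vals : seq Z) (n : nat) : seq (seq Z) :=
  if n is n'.+1 then [seq x :: v | x <- vals, v <- words vals n'] else [:: [::]].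

Lemma mem_words vals v : all (mem vals) v -> v \in words vals (size v).
Proof.
elim: v => [//|x v IHv] /= /andP[xv vv].
by apply/allpairsP; exists (x, v); rewrite IHv.
Qed.

(* [shift_profile e (shift_weights m)] lists [(PAF_(e + 12 m) - PAF_e) / 12] at
   the shifts 1, .., 4; by symmetry the shifts 5, .., 8 give the same values. *)
Definition shift_weights (m : seq Z) :=
  [seq (addZ (rot s m) (rotr s m), 12 * pafZ m s) | s <- iota 1 4].
Definition shift_profile (e : seq Z) (w : seq (seq Z * Z)) :=
  [seq dotZ e p.1 + p.2 | p <- w].

Definition signs := words [:: 1; -1] 9.
Definition corrections (k : Z) :=
  [seq m <- words [:: 0; 1; -1] 9 | (dotZ m m == k) && (sumZ m == 0)].
(** The weights are formed once for each correction, not once for each of the 512 sign words. *)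
Definition profiles k :=
  [seq shift_profile e w | w <- [seq shift_weights m | m <- corrections k],
                           e <- signs].

(** Covers the case [m' = 0]: the profile of [e'] is then zero, so that of [e] would be constantly
    -6. *)
Lemma profile4_check : all (fun m => let w := shift_weights m in
  all (fun e => ~~ all (fun p => dotZ e p.1 + p.2 == -6) w) signs) (corrections 4).
Proof. by vm_compute. Qed.

(** A correction of squared norm 2 and sum 0 has one entry 1 and one entry -1, so its
    autocorrelation at a nonzero shift is 0 or -1. A profile entry is thus 0 or -12 plus an even
    number in [-4, 4] coming from the signs. *)
Definition profile2_entries := [:: -16; -14; -12; -10; -8; -4; -2; 0; 2; 4].

Lemma profile2_entries_check : all (all (mem profile2_entries)) (profiles 2).
Proof. by vm_compute. Qed.

(* A cheap necessary condition for [-6 - g] to be a profile, which leaves only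
   30 distinct profiles to be compared. *)
Definition opposite_entries g := all (fun x => -6 - x \in profile2_entries) g.

Lemma profile2_check :
  let gs := undup [seq g <- profiles 2 | opposite_entries g] in
  all (fun g => [seq -6 - x | x <- g] \notin gs) gs.
Proof. by vm_compute. Qed.

Lemma pm1P x : pm1 x -> x = 1 \/ x = -1.
Proof. by rewrite /pm1 /= !inE => /orP[]/eqP; [left|right]. Qed.

Lemma dotZ_le_size u v : all pm1 u -> all pm1 v -> Z.abs (dotZ u v) <= Z.of_nat (size u).
Proof.
elim: u v => [|x u IHu] [|y v] //= /andP[/pm1P xP /IHu{}IHu] /andP[/pm1P yP /IHu].
by case: xP => ->; case: yP => ->; lia.
Qed.

Lemma sumZ_le_size u : all pm1 u -> Z.abs (sumZ u) <= Z.of_nat (size u).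
Proof.
elim: u => [|x u IHu] //= /andP[/pm1P xP /IHu].
by case: xP => ->; rewrite sumZ_cons; lia.
Qed.

Lemma sumZ_addZ u v : size u = size v -> sumZ (addZ u v) = sumZ u + sumZ v.
Proof.
elim: u v => [|x u IHu] [|y v] //= [/IHu IH].
by rewrite addZ_cons !sumZ_cons IH; lia.
Qed.

Lemma sumZ_scale c u : sumZ [seq c * x | x <- u] = c * sumZ u.
Proof.
by elim: u => [|x u IHu] /=; rewrite ?sumZ_cons ?IHu; first rewrite /sumZ /=; lia.
Qed.

Lemma sumZ_cat u v : sumZ (u ++ v) = sumZ u + sumZ v.
Proof. by elim: u => [|x u IHu] //=; rewrite !sumZ_cons IHu; lia. Qed.

Lemma sumZ_rot s u : sumZ (rot s u) = sumZ u.
Proof. by rewrite -[in RHS](cat_take_drop s u) /rot !sumZ_cat Z.add_comm. Qed.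

Lemma dotZ_parity u v : size u = size v -> all pm1 u ->
  exists k, dotZ u v = sumZ v + 2 * k.
Proof.
elim: u v => [|x u IHu] [|y v] //=; first by exists 0.
move=> [/IHu{}IHu] /andP[/pm1P xP /IHu[k ->]]; rewrite sumZ_cons.
by case: xP => ->; [exists k | exists (k - y)]; lia.
Qed.

(** For a sign [x], the square of [x + 12 y] is [1 + 24 x y + 144 y^2], and [|y| <= y^2] for an
    integer [y]. *)
Lemma dotZ_add12_bounds e m : size e = size m -> all pm1 e ->
  let a := addZ e [seq 12 * x | x <- m] in
  Z.of_nat (size e) + 120 * dotZ m m <= dotZ a a <= Z.of_nat (size e) + 168 * dotZ m m.
Proof.
elim: e m => [|x e IHe] [|y m] //=.
rewrite -/(addZ e _) => -[/IHe{}IHe] /andP[/pm1P xP /IHe/=].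
have yy : Z.abs y <= y * y by nia.
by case: xP => ->; lia.
Qed.

Lemma sumZ_dotZ_parity m : exists k, dotZ m m = sumZ m + 2 * k.
Proof.
elim: m => [|x m [k IHm]]; first by exists 0.
have [j jE] : exists j, x * x = x + 2 * j.
  by case: (Z.Even_or_Odd x) => -[i ->]; [exists (2 * i * i - i)|exists (2 * i * i + i)]; lia.
by exists (k + j); rewrite sumZ_cons /= IHm jE; lia.
Qed.

(** The entries other than [x] sum to [sumZ m - x], and the sum of their squares is at least the
    absolute value of that. *)
Lemma mem_sqr_bound m x : x \in m -> x * x + Z.abs (sumZ m - x) <= dotZ m m.
Proof.
have sum_le u : Z.abs (sumZ u) <= dotZ u u.
  by elim: u => //= y u; rewrite sumZ_cons; nia.
elim: m => //= y m IHm; rewrite inE => /orP[/eqP->|/IHm]; last first.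
  by rewrite sumZ_cons; nia.
by have := sum_le m; rewrite sumZ_cons; lia.
Qed.

Lemma mem_corrections m : size m = 9%N -> sumZ m = 0 -> dotZ m m <= 4 ->
  m \in corrections (dotZ m m).
Proof.
move=> sm m0 m4; rewrite mem_filter m0 !eqxx -sm mem_words //.
apply/allP => x /mem_sqr_bound; rewrite m0 !inE => xm.
(* As the sum is 0, the bound reads [x^2 + |x| <= 4]. *)
have : -1 <= x <= 1 by nia.
by move=> ?; have [->|[->|->]] : x = 0 \/ x = 1 \/ x = -1 by lia.
Qed.

Definition profile e m := shift_profile e (shift_weights m).

(** Replaces a word of length 9 by nine variables, on which [ring] can prove identities. *)
Lemma size9P (P : seq Z -> Prop) :
  (forall a b c d e f g h i, P [:: a; b; c; d; e; f; g; h; i]) ->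
  forall u, size u = 9%N -> P u.
Proof. by move=> Pu; do 9![case=> // ?]; case=> // _; apply: Pu. Qed.

Lemma paf_profile e m s : size e = 9%N -> size m = 9%N -> (s < 4)%N ->
  pafZ (addZ e [seq 12 * x | x <- m]) s.+1 = pafZ e s.+1 + 12 * nth 0 (profile e m) s.
Proof.
move=> se sm; move: e se m sm s.
apply: size9P => e0 e1 e2 e3 e4 e5 e6 e7 e8; apply: size9P => m0 m1 m2 m3 m4 m5 m6 m7 m8.
case=> [|[|[|[|//]]]] _;
  by rewrite /profile /pafZ /shift_profile /shift_weights /addZ /rotr /= /pafZ /=; ring.
Qed.

(** The weights at a shift add two rotations of [m], so they sum to 0, and signs do not affect
    parity. *)
Lemma profile_even e m s : size e = size m -> sumZ m = 0 -> all pm1 e -> (s < 4)%N ->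
  exists k, nth 0 (profile e m) s = 2 * k.
Proof.
move=> se m0 ep s4.
rewrite (nth_map ([::], 0)) // (nth_map 0%N) // nth_iota //=.
have [k ->] := @dotZ_parity e (addZ (rot s.+1 m) (rotr s.+1 m))
                 ltac:(by rewrite /addZ size_map size_zip size_rot size_rotr minnn) ep.
rewrite sumZ_addZ ?size_rot ?size_rotr // /rotr !sumZ_rot m0.
by exists (k + 6 * pafZ m (1 + s)%N); lia.
Qed.

Lemma size_profile e m : size (profile e m) = 4%N.
Proof. by rewrite /profile !size_map. Qed.

Lemma profile_sum e m e' m' s :
    size e = 9%N -> size m = 9%N -> size e' = 9%N -> size m' = 9%N ->
    all pm1 e -> all pm1 e' -> sumZ m = 0 -> sumZ m' = 0 -> (s < 4)%N ->
  pafZ (addZ e [seq 12 * x | x <- m]) s.+1 +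
    pafZ (addZ e' [seq 12 * x | x <- m']) s.+1 = -74 ->
  nth 0 (profile e m) s + nth 0 (profile e' m') s = -6.
Proof.
move=> se sm se' sm' ep ep' m0 m0' s4; rewrite !paf_profile //.
(* As [|PAF_e + PAF_e'| <= 18], the sum is -5, -6 or -7; it is also even. *)
have [[j ->] [k ->]] := (profile_even (etrans se (esym sm)) m0 ep s4,
                          profile_even (etrans se' (esym sm')) m0' ep' s4).
have : Z.abs (pafZ e s.+1) <= 9.
  by rewrite -[9]/(Z.of_nat 9) -se; apply: dotZ_le_size; rewrite ?(eq_all_r (mem_rot _ _)).
have : Z.abs (pafZ e' s.+1) <= 9.
  by rewrite -[9]/(Z.of_nat 9) -se'; apply: dotZ_le_size; rewrite ?(eq_all_r (mem_rot _ _)).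
by lia.
Qed.

Lemma mem_signs e : size e = 9%N -> all pm1 e -> e \in signs.
Proof. by move=> se ep; rewrite /signs -se mem_words. Qed.

Lemma mem_profiles k e m : e \in signs -> m \in corrections k -> profile e m \in profiles k.
Proof.
by move=> es mk; apply: (@allpairs_f _ _ _ (fun w f => shift_profile f w)); first exact: map_f.
Qed.

Lemma profile4_neq e m : e \in signs -> m \in corrections 4 -> profile e m <> nseq 4 (-6).
Proof.
move=> es m4 eE; have /negP := allP (allP profile4_check _ m4) _ es; apply.
suff: all (pred1 (-6)) (profile e m) by rewrite all_map.
by rewrite eE.
Qed.

Lemma profile2_subset e m : e \in signs -> m \in corrections 2 ->
  {subset profile e m <= profile2_entries}.
Proof. by move=> es m2; apply/allP; apply: (allP profile2_entries_check); apply: mem_profiles. Qed.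

(** Stated for an arbitrary list, so that the rewriting never meets the concrete list of
    profiles. *)
Lemma undup_filter_check (T : eqType) (P : pred T) (f : T -> T) (s : seq T) :
  (let gs := undup [seq g <- s | P g] in all (fun g => f g \notin gs) gs) ->
  forall g, g \in s -> P g -> f g \in s -> P (f g) -> False.
Proof.
move=> /allP chk g gs Pg fgs Pfg; have := chk g.
by rewrite !mem_undup !mem_filter gs Pg fgs Pfg => /(_ isT).
Qed.

Lemma profile2_neq e m e' m' :
    e \in signs -> m \in corrections 2 -> e' \in signs -> m' \in corrections 2 ->
  profile e' m' <> [seq -6 - x | x <- profile e m].
Proof.
move=> es m2 es' m2' E.
have g := mem_profiles es m2; have g' := mem_profiles es' m2'.
apply: (undup_filter_check profile2_check g); rewrite -?E //.
  by apply/allP => x xg; apply: (profile2_subset es' m2'); rewrite E; apply: map_f.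
apply/allP => x; rewrite E => /mapP[y yg ->].
by rewrite (_ : -6 - (-6 - y) = y); [apply: (profile2_subset es m2) | lia].
Qed.

Lemma profiles_incompatible e m e' m' :
    size e = 9%N -> size m = 9%N -> size e' = 9%N -> size m' = 9%N ->
    all pm1 e -> all pm1 e' -> sumZ m = 0 -> sumZ m' = 0 ->
    dotZ m m + dotZ m' m' = 4 ->
    (forall s, (s < 4)%N -> nth 0 (profile e m) s + nth 0 (profile e' m') s = -6) ->
  False.
Proof.
wlog le_mm' : e m e' m' / dotZ m' m' <= dotZ m m.
  move=> IH se sm se' sm' ep ep' m0 m0' mm H.
  have [le|lt] := Z_le_gt_dec (dotZ m' m') (dotZ m m); first exact: (IH e m e' m').
  by apply: (IH e' m' e m) => // [||s s4]; rewrite 1?Z.add_comm ?H //; lia.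
move=> se sm se' sm' ep ep' m0 m0' mm H.
have sqr_ge0 u : 0 <= dotZ u u by elim: u => //= x u; nia.
(* Both squared norms are even because the sums are 0; being ordered with sum 4, they are 4 and 0 or
   2 and 2. *)
have [[j mj] [k mk]] := (sumZ_dotZ_parity m, sumZ_dotZ_parity m').
have [m4|m4] : dotZ m m = 4 \/ dotZ m m = 2.
  by have := sqr_ge0 m; have := sqr_ge0 m'; lia.
- have m'0 : m' = nseq 9 0.
    rewrite -sm'; apply/all_pred1P/allP => x /mem_sqr_bound xm.
    by apply/eqP; nia.
  have g'0 s : (s < 4)%N -> nth 0 (profile e' m') s = 0.
    rewrite m'0; move: e' se' {ep' H}; apply: size9P => e0 e1 e2 e3 e4 e5 e6 e7 e8.
    by case: s => [|[|[|[|//]]]] _;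
      rewrite /profile /pafZ /shift_profile /shift_weights /addZ /rotr /= /pafZ /=; ring.
  have mc : m \in corrections 4 by rewrite -m4 mem_corrections //; lia.
  apply: (profile4_neq (mem_signs se ep) mc).
  apply: (@eq_from_nth _ 0) => [|s]; rewrite size_profile // => s4.
  by rewrite nth_nseq s4 -(H s s4) g'0 // Z.add_0_r.
have mc : m \in corrections 2 by rewrite -m4 mem_corrections //; lia.
have m4' : dotZ m' m' = 2 by lia.
have mc' : m' \in corrections 2 by rewrite -m4' mem_corrections //; lia.
apply: (profile2_neq (mem_signs se ep) mc (mem_signs se' ep') mc').
apply: (@eq_from_nth _ 0) => [|s]; rewrite size_profile; last move=> s4.
  by rewrite (size_map (fun x => -6 - x)) size_profile.
by rewrite (nth_map 0) ?size_profile // -(H s s4); lia.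
Qed.

(** The constants come from 668 and 74: [594 = 668 - 74] at shift 0, and [2 = 668 - 9 * 74] for the
    sum over all shifts. *)
Lemma no_pairZ e m e' m' :
    size e = 9%N -> size m = 9%N -> size e' = 9%N -> size m' = 9%N ->
    all pm1 e -> all pm1 e' ->
    let a := addZ e [seq 12 * x | x <- m] in
    let b := addZ e' [seq 12 * x | x <- m'] in
    pafZ a 0 + pafZ b 0 = 594 ->
    (forall s, (s < 4)%N -> pafZ a s.+1 + pafZ b s.+1 = -74) ->
    sumZ a * sumZ a + sumZ b * sumZ b = 2 ->
  False.
Proof.
move=> se sm se' sm' ep ep' a b; rewrite /pafZ !rot0 => ab0 ab sum_ab.
(* If N is the left side, [594 - 18 = 576] lies between [120 N] and [168 N], which forces N = 4. *)
have mm4 : dotZ m m + dotZ m' m' = 4.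
  have := dotZ_add12_bounds (etrans se (esym sm)) ep.
  have := dotZ_add12_bounds (etrans se' (esym sm')) ep'.
  by rewrite -/a -/b se se' -[Z.of_nat 9]/9; lia.
(* The sums of [a] and [e] are at most 1 and 9 in absolute value, so their difference [12 * sumZ m]
   is 0; likewise for [m']. *)
have [m0 m0'] : sumZ m = 0 /\ sumZ m' = 0.
  have ones x y : x * x + y * y = 2 -> Z.abs x <= 1 /\ Z.abs y <= 1 by nia.
  have := sumZ_le_size ep; have := sumZ_le_size ep'.
  move: sum_ab => /ones; rewrite /a /b !sumZ_addZ ?size_map ?se ?sm ?se' ?sm' //.
  by rewrite !sumZ_scale -[Z.of_nat 9]/9; lia.
apply: (profiles_incompatible se sm se' sm' ep ep' m0 m0' mm4) => s s4.
by apply: profile_sum => //; apply: ab.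
Qed.

End NinthCompression.

(** * Autocorrelations and compression *)

Section Autocorrelation.
Import GRing.Theory Num.Theory.
Local Open Scope ring_scope.

Lemma sum_Zp (V : nmodType) n (f : 'Z_n -> V) : (1 < n)%N ->
  \sum_j f j = \sum_(0 <= k < n) f k%:R.
Proof.
move=> n_gt1; transitivity (\sum_(0 <= k < (Zp_trunc n).+2) f k%:R).
  by rewrite big_mkord; apply: eq_bigr => j _; rewrite natr_Zp.
by apply: congr_big => //; rewrite Zp_cast.
Qed.

Lemma sum_PAF (R : pzRingType) L (x : 'Z_L -> R) : \sum_s PAF x s = (\sum_i x i) ^+ 2.
Proof.
rewrite /PAF exchange_big /= expr2 mulr_suml; apply: eq_bigr => j _.
by rewrite -mulr_sumr; congr (_ * _); rewrite [RHS](reindex_inj (addrI j)).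
Qed.

Lemma eq_PAF (R : pzRingType) L (x y : 'Z_L -> R) s : x =1 y -> PAF x s = PAF y s.
Proof. by move=> xy; apply: eq_bigr => j _; rewrite !xy. Qed.

Lemma sqr_le_PAF0 n (x y : 'Z_n -> int) j : x j ^+ 2 <= PAF x 0 + PAF y 0.
Proof.
have ge0 (I : finType) (P : pred I) (f : I -> int) : 0 <= \sum_(i | P i) f i * f i.
  by apply: sumr_ge0 => i _; rewrite -expr2 sqr_ge0.
have PAF0 (f : 'Z_n -> int) : PAF f 0 = \sum_i f i * f i.
  by apply: eq_bigr => i _; rewrite addr0.
by rewrite !PAF0 (bigD1 j) //= -expr2 -addrA lerDl addr_ge0 ?ge0.
Qed.

Lemma sum_PAF_pair n (x y : 'Z_n -> int) (c d : int) : (1 < n)%N ->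
    (forall s, PAF x s + PAF y s = c *+ (s == 0) - d) ->
  (\sum_i x i) ^+ 2 + (\sum_i y i) ^+ 2 = c - d *+ n.
Proof.
move=> n_gt1 xy; rewrite -!sum_PAF -big_split /= (eq_bigr _ (fun s _ => xy s)) sumrB.
rewrite (bigD1 0) //= big1 ?addr0 => [|s /negPf->]; last by rewrite mulr0n.
by rewrite sumr_const card_ord Zp_cast.
Qed.

End Autocorrelation.

Section Compression.
Import GRing.Theory.
Local Open Scope ring_scope.

Variables (L d : nat).
Hypotheses (d_gt1 : (1 < d)%N) (L_gt1 : (1 < L)%N) (dL : (d %| L)%N).

Definition residue (i : 'Z_L) : 'Z_d := (i : nat)%:R.

Lemma residue_nat n : residue n%:R = n%:R.
Proof. by rewrite /residue val_Zp_nat // -Zp_nat_mod // modn_dvdm // Zp_nat_mod. Qed.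

Lemma residue_nat_eq n (k : 'Z_d) : (residue n%:R == k) = (n %% d == k)%N.
Proof. by rewrite residue_nat -(inj_eq val_inj) [val _]val_Zp_nat. Qed.

Lemma residueD i j : residue (i + j) = residue i + residue j.
Proof. by rewrite -{1}[i]natr_Zp -{1}[j]natr_Zp -natrD residue_nat natrD. Qed.

Lemma residueM i j : residue (i * j) = residue i * residue j.
Proof. by rewrite -{1}[i]natr_Zp -{1}[j]natr_Zp -natrM residue_nat natrM. Qed.

(** The fibres of the reduction are translates of the one over 0, and [d] of them partition
    ['Z_L]. *)
Lemma card_residue k : #|[pred i | residue i == k]| = (L %/ d)%N.
Proof.
have fiberE k' : #|[pred i | residue i == k']| = #|[pred i | residue i == (0 : 'Z_d)]|.
  rewrite -!sum1_card /= (reindex_inj (addIr (nat_of_ord k')%:R)) /=.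
  apply: eq_bigl => i; rewrite !inE residueD residue_nat natr_Zp.
  by rewrite -{2}[k']add0r (inj_eq (addIr _)).
set c := #|[pred i | residue i == (0 : 'Z_d)]| in fiberE.
have := card_Zp (ltnW L_gt1); rewrite /Zp L_gt1 cardsT -sum1_card.
rewrite (partition_big residue xpredT) //= => sumL.
have : (d * c = L)%N.
  rewrite -[RHS]sumL (eq_bigr (fun=> c)); last first.
    by move=> k' _; rewrite -(fiberE k') -sum1_card.
  by rewrite sum_nat_const; congr muln; rewrite card_ord Zp_cast.
by rewrite fiberE => {1}<-; rewrite mulKn // ltnW.
Qed.

Section Rings.
Variable R : comPzRingType.
Definition compress (x : 'Z_L -> R) (k : 'Z_d) : R := \sum_(i | residue i == k) x i.

Lemma compress_nat x k : compress x k = \sum_(0 <= i < L | (i %% d == k)%N) x i%:R.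
Proof.
rewrite /compress big_mkcond sum_Zp // [RHS]big_mkcond.
by apply: eq_bigr => i _; rewrite residue_nat_eq.
Qed.

(** Reduction is additive: if [i] lies over [k], then [i + t] lies over [k + s] exactly when [t]
    lies over [s]. *)
Lemma PAF_compress x s : PAF (compress x) s = \sum_(t | residue t == s) PAF x t.
Proof.
rewrite /PAF [RHS]exchange_big [RHS](partition_big residue xpredT) //=.
apply: eq_bigr => k _; rewrite mulr_suml; apply: eq_bigr => i /eqP ik.
rewrite -mulr_sumr; congr (_ * _); rewrite /compress (reindex_inj (addrI i)).
by apply: eq_bigl => t; rewrite residueD ik (inj_eq (addrI _)).
Qed.

Lemma compress_invariant (x : 'Z_L -> R) r : coprime L r ->
  (forall i, x (r%:R * i) = x i) ->
  forall k, compress x (r%:R * k) = compress x k.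
Proof.
move=> co_Lr xr k; have Ur : (r%:R : 'Z_L) \is a GRing.unit by rewrite unitZpE.
rewrite /compress (reindex_inj (mulrI Ur)); apply: eq_big => [i|i _]; last exact: xr.
have Ud : (r%:R : 'Z_d) \is a GRing.unit.
  by rewrite unitZpE // (coprime_dvdl dL).
by rewrite residueM residue_nat (inj_eq (mulrI Ud)).
Qed.
End Rings.

(** At shift 0 the value is [2 L], which exceeds the common value -2 by [2 L + 2]. *)
Lemma PAF_Legendre a b t : @Legendre_pair L a b ->
  PAF a t + PAF b t = (2 * L + 2)%N%:R *+ (t == 0) - 2.
Proof.
case=> _ ap bp ab; have [->|t0] := eqVneq t 0; last first.
  rewrite -[t]natr_Zp ab; first by rewrite mulr0n add0r.
  by rewrite lt0n -(inj_eq val_inj) in t0 *; rewrite t0 -{2}(Zp_cast L_gt1) ltn_ord.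
have PAF0 (x : 'Z_L -> int) : pm1_seq x -> PAF x 0 = L%:R.
  move=> xp; rewrite /PAF (eq_bigr (fun=> 1)) => [|j _]; last first.
    by rewrite addr0; case: (xp j) => ->.
  by rewrite sumr_const card_ord Zp_cast.
by rewrite !PAF0 // mulr1n natrD addrK mul2n -addnn natrD.
Qed.

Lemma PAF_compress_Legendre a b s : @Legendre_pair L a b ->
  PAF (compress a) s + PAF (compress b) s =
    (2 * L + 2)%N%:R *+ (s == 0) - (2 * (L %/ d))%N%:R.
Proof.
move=> ab; rewrite !PAF_compress -big_split /=.
rewrite (eq_bigr _ (fun t _ => PAF_Legendre t ab)) big_split /= sumr_const.
rewrite (card_residue s) natrM mulNrn; congr (_ - _); last by rewrite mulr_natr.
have res0 : residue 0 = 0 by exact: (residue_nat 0).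
have [->|s0] := eqVneq s 0.
  rewrite (bigD1 0) ?res0 //= big1 ?addr0 // => t /andP[_ /negPf->].
  exact: mulr0n.
apply: big1 => t /eqP ts; case: eqP => // t0.
by rewrite -ts t0 res0 eqxx in s0.
Qed.

End Compression.

(** * The compression of length 37 *)

Section Modulo37.
Import Order.TTheory GRing.Theory Num.Theory.
Local Open Scope ring_scope.

Definition spectrum (R : comNzRingType) n (z : R) (x : 'Z_n -> int) : R :=
  \sum_j (x j)%:~R * z ^+ j.

Section Root.
Variables (R : comNzRingType) (n : nat) (z : R).
Hypotheses (n_gt1 : (1 < n)%N) (zn : z ^+ n = 1).

Lemma expr_nat_Zp m : z ^+ (m%:R : 'Z_n)%R = z ^+ m.
Proof. by rewrite val_Zp_nat // expr_mod. Qed.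

Lemma expr_Zp_add (i j : 'Z_n) : z ^+ (i + j)%R = z ^+ i * z ^+ j.
Proof. by rewrite -exprD -[in LHS](natr_Zp i) -[in LHS](natr_Zp j) -natrD expr_nat_Zp. Qed.

Lemma spectrum_invariant (x : 'Z_n -> int) r : coprime n r ->
  (forall k, x (r%:R * k) = x k) -> \sum_j (x j)%:~R * z ^+ (j * r) = spectrum z x.
Proof.
move=> co_nr xr; have Ur : (r%:R : 'Z_n) \is a GRing.unit by rewrite unitZpE.
rewrite /spectrum [RHS](reindex_inj (mulrI Ur)); apply: eq_bigr => j _.
by rewrite xr; congr (_ * _); rewrite -[in RHS](natr_Zp j) -natrM expr_nat_Zp mulnC.
Qed.

(** The transform of an autocorrelation is the product of the transforms at [z] and at its inverse;
    the symmetry of [x] makes these equal. *)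
Lemma spectrum_PAF (x : 'Z_n -> int) : (forall k, x (- k) = x k) ->
  spectrum z (PAF x) = spectrum z x ^+ 2.
Proof.
move=> xN; rewrite expr2 {2}/spectrum (reindex_inj oppr_inj) mulr_suml.
rewrite {1}/spectrum (eq_bigr (fun s => \sum_j (x j)%:~R * (x (j + s))%:~R * z ^+ s)).
  rewrite exchange_big; apply: eq_bigr => j _ /=.
  rewrite /spectrum mulr_sumr [RHS](reindex_inj (addrI j)); apply: eq_bigr => s _.
  have -> : z ^+ s = z ^+ (- j)%R * z ^+ (j + s)%R by rewrite -expr_Zp_add addKr.
  by rewrite xN mulrACA.
move=> s _; rewrite /PAF rmorph_sum mulr_suml; apply: eq_bigr => j _.
by rewrite rmorphM.
Qed.

Lemma spectrum_Frobenius p e (x : 'Z_n -> int) : p \in [pchar R] ->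
  spectrum z x ^+ (p ^ e) = \sum_j (x j)%:~R * z ^+ (j * p ^ e).
Proof.
move=> pR; elim: e => [|e IHe]; first by apply: eq_bigr => j _; rewrite muln1.
rewrite expnSr exprM IHe -(pFrobenius_autE pR) rmorph_sum /=.
apply: eq_bigr => j _; rewrite rmorphM rmorph_int /= pFrobenius_autE.
by rewrite -exprM mulnA.
Qed.

End Root.

(** Since 4 divides [q + 1], the relation [v^2 = - u^2] gives [u^(q+1) = v^(q+1)], that is
    [u^2 = v^2 = - u^2]. As 2 is invertible, [u^2 = 0], and [u = u^q] vanishes. *)
Lemma fixed_sqr_sum0 (R : comNzRingType) q (c u v : R) : (q %% 4 = 3)%N ->
  c * 2%:R = 1 -> u ^+ q = u -> v ^+ q = v -> u ^+ 2 + v ^+ 2 = 0 -> u = 0.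
Proof.
move=> q3 c2 uq vq uv0; have vE : v ^+ 2 = - u ^+ 2.
  by apply/eqP; rewrite -addr_eq0 addrC uv0.
have q1 : q.+1 = (2 * 2 * (q %/ 4).+1)%N by lia.
have : u ^+ q.+1 = v ^+ q.+1.
  by rewrite q1 -mulnA !exprM vE sqrrN.
rewrite !exprS uq vq -!expr2 vE => uu.
have u2 : u ^+ 2 = 0.
  by rewrite -[LHS]mul1r -c2 -mulrA mulr_natl mulr2n {2}uu subrr mulr0.
by rewrite -uq (_ : q = 2 + (q - 2))%N ?exprD ?u2 ?mul0r //; lia.
Qed.

Section RootRing.
Variables (F : comNzRingType) (n : nat).
Hypothesis n_gt1 : (1 < n)%N.

(** Unlike [X^n - 1], this modulus makes the powers of the root sum to 0, so constant sequences have
    transform 0. *)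
Definition geom_poly : {poly F} := \poly_(k < n) 1.
Definition root_ring := {poly %/ geom_poly}.
Definition root_of_1 : root_ring := in_qpoly geom_poly 'X.

Lemma size_geom_poly : size geom_poly = n.
Proof. by apply: size_poly_eq; rewrite oner_eq0. Qed.

(** The quotient is taken modulo [mk_monic], which substitutes ['X] for a polynomial that is
    constant or not monic; no substitution happens here. *)
Lemma mk_monic_geom_poly : mk_monic geom_poly = geom_poly.
Proof.
rewrite /mk_monic size_geom_poly n_gt1 monicE /lead_coef size_geom_poly.
by rewrite coef_poly ltn_predL ltnW // eqxx.
Qed.

Lemma in_qpoly_geom : in_qpoly geom_poly geom_poly = 0.
Proof.
apply: val_inj; rewrite /= mk_monic_geom_poly; apply: Pdiv.RingMonic.rmodpp.
by rewrite -mk_monic_geom_poly monic_mk_monic.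
Qed.

Lemma sum_root_of_1 : \sum_(k < n) root_of_1 ^+ k = 0.
Proof.
transitivity (in_qpoly geom_poly (\sum_(k < n) 1 *: 'X^k)).
  by rewrite rmorph_sum; apply: eq_bigr => k _; rewrite scale1r rmorphXn.
by rewrite -(poly_def n (fun=> 1)) in_qpoly_geom.
Qed.

(** Subtracting [f n.-1] times the modulus leaves degree below [n.-1], so the difference is its own
    class and hence 0. *)
Lemma in_qpoly_geom_eq0 (f : nat -> F) :
  in_qpoly geom_poly (\poly_(k < n) f k) = 0 -> forall i, (i < n)%N -> f i = f n.-1.
Proof.
set P := \poly_(k < n) f k => P0 i i_lt.
have coefP k : P`_k = if (k < n)%N then f k else 0 by rewrite coef_poly.
have PE : P = f n.-1 *: geom_poly.
  apply/eqP; rewrite -subr_eq0; apply/eqP.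
  rewrite -(@in_qpoly_small _ geom_poly (P - _)); last first.
    rewrite mk_monic_geom_poly size_geom_poly -{2}(prednK (ltnW n_gt1)) ltnS.
    apply/leq_sizeP => k nk; rewrite coefB coefZ coefP coef_poly.
    case: ltnP => [kn|_]; last by rewrite mulr0 subrr.
    by rewrite (_ : k = n.-1) ?mulr1 ?subrr //; lia.
  by rewrite -scaleNr in_qpolyD in_qpolyZ P0 in_qpoly_geom scaler0 addr0.
have := congr1 (fun Q : {poly F} => Q`_i) PE.
by rewrite coefP coefZ coef_poly i_lt mulr1.
Qed.

Lemma spectrum_root_eq0 (x : 'Z_n -> int) : spectrum root_of_1 x = 0 ->
  forall i j, (x i)%:~R = (x j)%:~R :> F.
Proof.
have -> : spectrum root_of_1 x = in_qpoly geom_poly (\poly_(k < n) (x k%:R)%:~R).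
  rewrite poly_def rmorph_sum /spectrum /=.
  transitivity (\sum_(0 <= k < n) (x k%:R)%:~R * root_of_1 ^+ (k%:R : 'Z_n)%R).
    exact: (sum_Zp (fun j : 'Z_n => (x j)%:~R * root_of_1 ^+ (j : nat)) n_gt1).
  rewrite big_mkord; apply: eq_bigr => k _.
  rewrite val_Zp_nat // modn_small //.
  by rewrite -mul_polyC rmorphM rmorphXn /= !rmorph_int.
move=> /in_qpoly_geom_eq0 x0.
have xE i : (x i)%:~R = (x n.-1%:R)%:~R :> F.
  by rewrite -(x0 i) ?natr_Zp // -{2}(Zp_cast n_gt1) ltn_ord.
by move=> i j; rewrite !xE.
Qed.
End RootRing.

Lemma spectrum37_eq0 (R : comNzRingType) (z : R) (a b : 'Z_37 -> int) (c d : int) :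
    167 \in [pchar R] -> (167 %| c)%Z -> \sum_(k < 37) z ^+ k = 0 ->
    (forall k, a (6%:R * k) = a k) -> (forall k, b (6%:R * k) = b k) ->
    (forall s, PAF a s + PAF b s = c *+ (s == 0) - d) ->
  spectrum z a = 0.
Proof.
move=> charR /dvdzP[m ->] z0 a6 b6 ab.
have z37 : z ^+ 37 = 1 by apply/eqP; rewrite -subr_eq0 subrX1 z0 mulr0.
have gt1 : (1 < 37)%N by [].
(* Invariance is applied twice, as [6 * 6 = -1] modulo 37. *)
have sym (x : 'Z_37 -> int) : (forall k, x (6%:R * k) = x k) -> forall k, x (- k) = x k.
  move=> x6 k; rewrite -[RHS]x6 -[RHS]x6 mulrA; congr x.
  by rewrite -mulN1r; congr (_ * _); apply/val_inj.
have R167 : 167%:R = 0 :> R by apply: pcharf0.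
(* The witness [167 ^ 9] stays behind the existential, so that this unary number is never expanded.
   Modulo 37, 167 is 19, its cube is 14, and the cube of 14 is 6. *)
have [q q3 [qR q37]] : exists2 q : nat, (q %% 4 = 3)%N &
    (forall x : 'Z_37 -> int, spectrum z x ^+ q = \sum_j (x j)%:~R * z ^+ (j * q)) /\
    (q %% 37 = 6)%N.
  exists (167 ^ 9)%N; first by rewrite -modnXm.
  split=> [x|]; first exact: spectrum_Frobenius.
  by rewrite -modnXm (expnM _ 3 3) -modnXm.
have fixed (x : 'Z_37 -> int) : (forall k, x (6%:R * k) = x k) -> spectrum z x ^+ q = spectrum z x.
  move=> x6; rewrite qR -(spectrum_invariant gt1 z37 _ x6); last by [].
  apply: eq_bigr => j _; congr (_ * _).
  by rewrite -(expr_mod _ z37) -modnMmr q37 expr_mod.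
have sum0 : spectrum z a ^+ 2 + spectrum z b ^+ 2 = 0.
  rewrite -(spectrum_PAF gt1 z37 (sym a a6)) -(spectrum_PAF gt1 z37 (sym b b6)).
  rewrite /spectrum -big_split /=.
  (* The term at shift 0 dies in characteristic 167; the constant [- d] contributes a multiple of
     the zero geometric sum. *)
  rewrite (eq_bigr (fun s : 'Z_37 => - d%:~R * z ^+ s)) => [|s _].
    by rewrite -mulr_sumr [X in _ * X]z0 mulr0.
  by rewrite -mulrDl -rmorphD ab rmorphB rmorphMn rmorphM /= [167%:~R]R167 mulr0 mul0rn sub0r.
have c2 : 84%:R * 2%:R = 1 :> R.
  have E : (84 * 2 = 167.+1)%N by [].
  by rewrite -natrM E mulrS R167 addr0.
by apply: (fixed_sqr_sum0 q3 c2 _ _ sum0); apply: fixed.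
Qed.

(** The first square is 0 or at least 4, and 2 is not a square. *)
Lemma mulrn_sqr_add_sqr_neq2 (u v : int) n : (1 < n)%N -> (u *+ n) ^+ 2 + v ^+ 2 <> 2.
Proof.
move=> n1; have [->|u0] := eqVneq u 0.
  rewrite mul0rn expr0n add0r => v2.
  have v_small : -2 < v < 2 by nia.
  have vE : v = -1 \/ v = 0 \/ v = 1 by lia.
  by case: vE v2 => [|[]] ->.
rewrite -[u *+ n]mulr_natr exprMn => H.
have : 1 <= u ^+ 2 by nia.
have : 4 <= (n%:R:int) ^+ 2 by nia.
by nia.
Qed.

(** Applied with [c = 668 = 4 * 167] and [d = 18], for which [c - d = 650] and [c - 37 * d = 2]. *)
Lemma no_pair_mod37 (a b : 'Z_37 -> int) (c d : int) :
    (167 %| c)%Z -> c - d <= 650 -> c - d *+ 37 = 2 ->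
    (forall k, a (6%:R * k) = a k) -> (forall k, b (6%:R * k) = b k) ->
    (forall s, PAF a s + PAF b s = c *+ (s == 0) - d) ->
  False.
Proof.
move=> c167 cd0 cd a6 b6 ab.
have charF : 167 \in [pchar 'F_167] by apply: pchar_Fp.
have gt1 : (1 < 37)%N by [].
have a_mod j : (167 %| a j - a 0%R)%Z.
  rewrite (dvdz_pcharf charF) rmorphB subr_eq0 /=; apply/eqP.
  apply: (spectrum_root_eq0 gt1).
  apply: (spectrum37_eq0 _ c167 _ a6 b6 ab); first by rewrite pchar_qpoly.
  exact: sum_root_of_1.
have bound j : `|a j| <= 25.
  by have := sqr_le_PAF0 a b j; rewrite ab eqxx mulr1n; nia.
(* Two entries differ by at most 50, and 167 divides the difference. *)
have a_const j : a j = a 0.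
  by have /dvdzP[k] := a_mod j; have := bound j; have := bound 0; lia.
have := sum_PAF_pair gt1 ab; rewrite cd (eq_bigr _ (fun j _ => a_const j)).
by rewrite sumr_const card_ord; apply: mulrn_sqr_add_sqr_neq2.
Qed.

End Modulo37.

(** * The compression of length 9 *)

Section Modulo9.
Import Order.TTheory GRing.Theory Num.Theory.
Local Open Scope ring_scope.
Local Arguments BinInt.Z.mul : simpl never.
Local Arguments BinInt.Z.add : simpl never.

Definition seqZ (x : 'Z_9 -> int) : seq Z := [seq Z_of_int (x k%:R) | k <- iota 0 9].

Lemma sumZ_seqZ x : sumZ (seqZ x) = Z_of_int (\sum_k x k).
Proof. by rewrite sum_Zp // /sumZ unlock /=; lia. Qed.

Lemma pafZ_seqZ x s : (s <= 4)%N -> pafZ (seqZ x) s = Z_of_int (PAF x s%:R).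
Proof.
move=> s4; pose y n := x n%:R.
have -> : PAF x s%:R = \sum_(0 <= k < 9) y k * y ((k + s) %% 9)%N.
  rewrite /PAF sum_Zp //; apply: eq_bigr => k _.
  by rewrite /y Zp_nat_mod // natrD.
have -> : seqZ x = [seq Z_of_int (y k) | k <- iota 0 9] by [].
move: y => y {x}; rewrite unlock.
(* The cyclic indices are turned into numerals, so that both sides involve the same atoms [y k]. *)
case: s s4 => [|[|[|[|[|//]]]]] _; rewrite /pafZ /=;
  do 9?[match goal with |- context [(?i %% 9)%N] =>
    let r := eval vm_compute in (i %% 9)%N in rewrite -[(i %% 9)%N]/r
  end]; lia.
Qed.

Lemma seqZ_add12 (e m : 'Z_9 -> int) :
  seqZ (fun k => e k + 12 * m k) = addZ (seqZ e) [seq BinInt.Z.mul 12 z | z <- seqZ m].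
Proof.
rewrite /seqZ /addZ -[X in zip _ X]map_comp zip_map -[RHS]map_comp.
by apply: eq_map => k /=; lia.
Qed.

Lemma no_pair_mod9 (e m e' m' : 'Z_9 -> int) (c d : int) :
    c - d = 594 -> d = 74 ->
    (forall k, e k = 1 \/ e k = -1) -> (forall k, e' k = 1 \/ e' k = -1) ->
    (forall s, PAF (fun k => e k + 12 * m k) s + PAF (fun k => e' k + 12 * m' k) s
       = c *+ (s == 0) - d) ->
  False.
Proof.
move=> cd dE ep ep' em.
have pm1_seqZ (f : 'Z_9 -> int) : (forall k, f k = 1 \/ f k = -1) -> all pm1 (seqZ f).
  by move=> fp; rewrite all_map; apply/allP => k _ /=; case: (fp k%:R) => ->.
have ez := pm1_seqZ e ep; have e'z := pm1_seqZ e' ep'.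
pose A := fun k => e k + 12 * m k; pose B := fun k => e' k + 12 * m' k.
have abE s : (s <= 4)%N -> BinInt.Z.add (pafZ (seqZ A) s) (pafZ (seqZ B) s) =
    Z_of_int (c *+ (s%:R == 0 :> 'Z_9) - d).
  by move=> s4; rewrite !pafZ_seqZ // -em -/A -/B; lia.
apply: (@no_pairZ (seqZ e) (seqZ m) (seqZ e') (seqZ m')) => //; rewrite -!seqZ_add12.
- by rewrite abE // eqxx; lia.
- by move=> s s4; rewrite abE //; case: s s4 => [|[|[|[|//]]]] _; rewrite mulr0n; lia.
have := sum_PAF_pair (isT : (1 < 9)%N) em; rewrite -/A -/B.
rewrite !sumZ_seqZ !expr2 (_ : c - d *+ 9 = 2); last by rewrite -mulr_natr; lia.
by move: (\sum_k A k) (\sum_k B k) => u v; lia.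
Qed.

End Modulo9.

(** * Invariant Legendre pairs of length 333 *)

Section Length333.
Import Order.TTheory GRing.Theory Num.Theory.
Local Open Scope ring_scope.

(** Both groups are cyclic on their second generator: modulo 333, 73 is the square of 154 and 10 is
    the fourth power of 64. *)
Lemma gen2_cycle (gT : finGroupType) (x y : gT) : x \in <[y]>%g -> <<[set x; y]>>%g = <[y]>%g.
Proof.
move=> xy; apply/eqP; rewrite eqEsubset gen_subG subUset !sub1set xy cycle_id /=.
by rewrite cycle_subG mem_gen // !inE eqxx orbT.
Qed.

Lemma order_unit_dvdn (u : {unit 'Z_333}) n : (#[u]%g %| n)%N = (val u ^+ n == 1).
Proof. by rewrite order_dvdn -(inj_eq val_inj) [val (u ^+ n)%g]FinRing.val_unitX. Qed.

Lemma mem_cycle_unit (u v : {unit 'Z_333}) n : val u = val v ^+ n -> u \in <[v]>%g.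
Proof.
by move=> uv; apply/cycleP; exists n; apply: val_inj; rewrite uv [RHS]FinRing.val_unitX.
Qed.

Lemma card_H_73_154 : #|H_73_154| = 4%N.
Proof.
rewrite /= gen2_cycle; last first.
  by apply: (@mem_cycle_unit _ _ 2); apply/val_inj; vm_compute.
set y := residue_unit _ _; rewrite -[LHS]/#[y]%g.
have y4 : (#[y]%g %| 4)%N by rewrite order_unit_dvdn; vm_compute.
have : ~~ (#[y]%g %| 2)%N by rewrite order_unit_dvdn; vm_compute.
move: y4 (dvdn_leq (isT : (0 < 4)%N) y4).
by move: #[y]%g => -[|[|[|[|[]]]]].
Qed.

Lemma card_H_10_64 : #|H_10_64| = 6%N.
Proof.
rewrite /= gen2_cycle; last first.
  by apply: (@mem_cycle_unit _ _ 4); apply/val_inj; vm_compute.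
set y := residue_unit _ _; rewrite -[LHS]/#[y]%g.
have y6 : (#[y]%g %| 6)%N by rewrite order_unit_dvdn; vm_compute.
have : ~~ (#[y]%g %| 2)%N by rewrite order_unit_dvdn; vm_compute.
have : ~~ (#[y]%g %| 3)%N by rewrite order_unit_dvdn; vm_compute.
move: y6 (dvdn_leq (isT : (0 < 6)%N) y6).
by move: #[y]%g => -[|[|[|[|[|[|[]]]]]]].
Qed.

Lemma sum_signs (I : Type) (s : seq I) (f : I -> int) : (forall i, f i = 1 \/ f i = -1) ->
  exists m, \sum_(i <- s) f i = (size s)%:R - 2 * m.
Proof.
move=> f1; elim: s => [|i s [m IHs]]; first by exists 0; rewrite big_nil /= mulr0 subr0.
rewrite big_cons IHs /=; case: (f1 i) => ->; [exists m | exists (m + 1)]; lia.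
Qed.

(* The residues [37 k + 9 v], for [0 <= v < 37], are those congruent to [k]
   modulo 9, since [37 = 1 (mod 9)]. *)
Lemma sum_fiber9 (y : nat -> int) k : (k < 9)%N -> (forall n, y (n %% 333)%N = y n) ->
  \sum_(0 <= i < 333 | (i %% 9 == k)%N) y i = \sum_(v <- iota 0 37) y (37 * k + 9 * v)%N.
Proof.
move=> k9 y_mod.
have fibers : all (fun k : nat => perm_eq [seq i <- iota 0 333 | i %% 9 == k]%N
    [seq ((37 * k + 9 * v) %% 333)%N | v <- iota 0 37]) (iota 0 9).
  by vm_compute.
have k_in : k \in iota 0 9 by rewrite mem_iota.
rewrite -big_filter (perm_big _ (allP fibers _ k_in)) big_map.
by apply: eq_bigr.
Qed.

(** As 64 is 1 modulo 9 and 27 modulo 37, it acts on the fibre over [k] by [v -> 27 v] modulo 37,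
    fixing [v = 0] and splitting the rest into six orbits of length 6. *)
Lemma compress9_invariant (x : 'Z_333 -> int) (k : 'Z_9) : pm1_seq x ->
  (forall i, x (64%:R * i) = x i) ->
  exists m, compress x k = x (37 * k)%N%:R + 12 * m.
Proof.
move=> x1 x64; pose F v := x (37 * k + 9 * v)%N%:R.
have -> : compress x k = \sum_(v <- iota 0 37) F v.
  rewrite compress_nat // (@sum_fiber9 (fun n => x n%:R)) ?[(k < 9)%N]ltn_ord // => n.
  by rewrite Zp_nat_mod.
have F27 v : F ((27 * v) %% 37)%N = F v.
  rewrite /F -[RHS]x64 -natrM -[in RHS]Zp_nat_mod // -[in LHS]Zp_nat_mod //.
  (* The quotient by 333 comes from [64 * 37 = 7 * 333 + 37] and [64 * 9 = 333 + 9 * 27]. *)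
  congr (x _%:R); rewrite -[in LHS](modnMDl (7 * k + v + (27 * v) %/ 37)).
  by congr (_ %% _)%N; lia.
(* As 2 is a primitive root modulo 37, its powers [2 ^ r] with [r < 6] represent the cosets of the
   subgroup of order 6. *)
have orbits : perm_eq (iota 0 37)
    (0%N :: flatten [seq traject (fun v => (27 * v) %% 37)%N (2 ^ r)%N 6 | r <- iota 0 6]).
  by vm_compute.
have orbit_sum u : \sum_(v <- traject (fun v => (27 * v) %% 37)%N u 6) F v = 6 * F u.
  by rewrite /= !big_cons big_nil !F27; lia.
have [m mE] := sum_signs (iota 0 6) (fun r => x1 (37 * k + 9 * 2 ^ r)%N%:R).
(* Six signs sum to [6 - 2 m], and [6 * (6 - 2 m) = 12 * (3 - m)]. *)
exists (3 - m); rewrite (perm_big _ orbits).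
rewrite big_cons big_flatten big_map (eq_bigr _ (fun r _ => orbit_sum _)).
by rewrite -mulr_sumr mE /F muln0 addn0 /=; lia.
Qed.

Lemma no_invariant_pair_73_154 (a b : 'Z_333 -> int) :
  ~ invariant_Legendre_pair H_73_154 a b.
Proof.
case=> ab Ha Hb.
have h : @residue_unit 333 154 isT isT \in H_73_154 by rewrite mem_gen // !inE eqxx orbT.
have inv6 (x : 'Z_333 -> int) : seq_invariant H_73_154 x ->
    forall k : 'Z_37, compress x (6%:R * k) = compress x k.
  move=> Hx k; have <- : 154%:R = 6%:R :> 'Z_37 by apply/val_inj; vm_compute.
  by apply: compress_invariant => // i; apply: (Hx _ i h).
apply: (@no_pair_mod37 (compress a) (compress b) _ _ _ _ _ (inv6 a Ha) (inv6 b Hb)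
  (fun s => PAF_compress_Legendre _ _ _ s ab)) => //.
Qed.

Lemma no_invariant_pair_10_64 (a b : 'Z_333 -> int) :
  ~ invariant_Legendre_pair H_10_64 a b.
Proof.
case=> ab Ha Hb.
have h : @residue_unit 333 64 isT isT \in H_10_64 by rewrite mem_gen // !inE eqxx orbT.
have dec (x : 'Z_333 -> int) : pm1_seq x -> seq_invariant H_10_64 x ->
    exists m : 'Z_9 -> int, forall k, compress x k = x (37 * k)%N%:R + 12 * m k.
  move=> x1 Hx.
  apply: (@fin_all_exists _ _ (fun k m => compress x k = x (37 * k)%N%:R + 12 * m)) => k.
  by apply: compress9_invariant => // i; apply: (Hx _ i h).
case: (ab) => _ a1 b1 _.
have [m am] := dec a a1 Ha; have [m' bm'] := dec b b1 Hb.
apply: (@no_pair_mod9 (fun k => a (37 * k)%N%:R) m (fun k => b (37 * k)%N%:R) m' (2 * 333 + 2)%N%:R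
  (2 * (333 %/ 9))%N%:R) => // s.
rewrite -(@PAF_compress_Legendre 333 9 isT isT isT a b s ab).
by rewrite (eq_PAF s am) (eq_PAF s bm').
Qed.

End Length333.

Theorem proposition4 :
  [/\ #|H_73_154| = 4%N, #|H_10_64| = 6%N &
      forall H : {group {unit 'Z_333}}, H = H_73_154 \/ H = H_10_64 ->
        ~ exists a b : 'Z_333 -> int, invariant_Legendre_pair H a b].
Proof.
split; [exact: card_H_73_154 | exact: card_H_10_64 |].
move=> H [->|->] [a [b ab]]; first exact: no_invariant_pair_73_154 ab.
exact: no_invariant_pair_10_64 ab.
Qed.
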